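(* Let $K$ be a field. Any $\mathrm{id}$-matching structure on $UT_3(K)$ is isomorphic to exactly one of the following structures (where $\alpha,\beta,\gamma$ are parameters in $K$, and products of basis elements that are not listed are zero): (1) $e_{13}\star e_{23}=e_{13}$, $e_{23}\star e_{12}=e_{12}$, $e_{23}\star e_{13}=e_{13}$, $e_{23}\star e_{23}=e_{23}$; (2) $e_{12}\star e_{12}=e_{12}$, $e_{12}\star e_{13}=e_{13}$, $e_{13}\star e_{23}=e_{13}$, $e_{23}\star e_{23}=e_{23}$; (3) $e_{13}\star e_{23}=e_{13}$, $e_{23}\star e_{23}=e_{23}$; (4) $e_{12}\star e_{12}=\alpha e_{13}$, $e_{12}\star e_{23}=\beta e_{13}$, $e_{23}\star e_{12}=\gamma e_{13}$, $e_{23}\star e_{23}=e_{13}$; (5) $e_{12}\star e_{12}=e_{12}$, $e_{12}\star e_{13}=e_{13}$, $e_{23}\star e_{12}=e_{23}$, $e_{13}\star e_{12}=e_{13}$; (6) $e_{12}\star e_{12}=e_{12}$, $e_{12}\star e_{13}=e_{13}$; (7) $e_{12}\star e_{12}=e_{13}$, $e_{12}\star e_{23}=\alpha e_{13}$, $e_{23}\star e_{12}=\beta e_{13}$; (8) $e_{12}\star e_{23}=\alpha e_{13}$, $e_{23}\star e_{12}=\beta e_{13}$.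
   Context: $K$ is an arbitrary field; all products are $K$-bilinear. $UT_3(K)$ is the associative algebra of strictly upper triangular $3\times 3$ matrices over $K$ with the usual matrix product $\cdot$; it has $K$-basis $e_{12},e_{23},e_{13}$ of matrix units, and the only nonzero product of basis elements is $e_{12}\cdot e_{23}=e_{13}$. An $\mathrm{id}$-matching structure on an associative algebra $(A,\cdot)$ is an associative bilinear product $*$ on $A$ such that $(a\cdot b)*c=a\cdot(b*c)$ and $(a*b)\cdot c=a*(b\cdot c)$ for all $a,b,c\in A$. Two such structures $*_1$ and $*_2$ on $(A,\cdot)$ are isomorphic if there is an algebra automorphism $\phi$ of $(A,\cdot)$ with $\phi(a*_1b)=\phi(a)*_2\phi(b)$ for all $a,b\in A$. In the families, different values of the parameters count as different structures. *)

(* Defs.v *)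
From HB Require Import structures.
From mathcomp Require Import all_boot all_order all_algebra.
From mathcomp Require Import sesquilinear.

Set Implicit Arguments.
Unset Strict Implicit.
Unset Printing Implicit Defensive.

Import GRing.Theory.
Local Open Scope ring_scope.

Section IdMatching.
Variables (K : fieldType) (A : lmodType K) (mul : A -> A -> A).
Implicit Types star : A -> A -> A.

Definition id_matching star : Prop :=
  [/\ bilinear_for *:%R *:%R star,
      associative star,
      forall a b c, star (mul a b) c = mul a (star b c) &
      forall a b c, mul (star a b) c = star a (mul b c)].

Definition algebra_automorphism (phi : A -> A) : Prop :=
  [/\ linear phi, bijective phi & {morph phi : a b / mul a b}].

Definition id_matching_isomorphic star1 star2 : Prop :=
  exists2 phi : A -> A, algebra_automorphism phi &
    forall a b, phi (star1 a b) = star2 (phi a) (phi b).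

End IdMatching.

Section StrictlyUpperTriangular.
Variables (K : fieldType) (n : nat).

Definition strictly_upper : {pred 'M[K]_n} :=
  fun M => [forall i : 'I_n, forall j : 'I_n, (j <= i)%N ==> (M i j == 0)].

Lemma strictly_upperP (M : 'M[K]_n) :
  reflect (forall i j : 'I_n, (j <= i)%N -> M i j = 0) (M \in strictly_upper).
Proof.
apply: (iffP forallP) => [M0 i j le_ji | M0 i].
  by move/forallP/(_ j)/implyP/(_ le_ji)/eqP: (M0 i).
by apply/forallP=> j; apply/implyP=> le_ji; rewrite M0.
Qed.

Lemma strictly_upper_submod : submod_closed strictly_upper.
Proof.
split=> [|a M N /strictly_upperP M0 /strictly_upperP N0].
  by apply/strictly_upperP=> i j _; rewrite mxE.
by apply/strictly_upperP=> i j le_ji; rewrite !mxE M0 // N0 // mulr0 addr0.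
Qed.

HB.instance Definition _ :=
  GRing.isSubmodClosed.Build K 'M[K]_n strictly_upper strictly_upper_submod.

Record UT : predArgType :=
  MkUT { UT_mx :> 'M[K]_n; UT_mxP : UT_mx \in strictly_upper }.

HB.instance Definition _ := [isSub for UT_mx].
HB.instance Definition _ := [Choice of UT by <:].
HB.instance Definition _ := [SubChoice_isSubLmodule of UT by <:].

Lemma UT_mul_subproof (a b : UT) :
  UT_mx a *m UT_mx b \in strictly_upper.
Proof.
apply/strictly_upperP=> i j le_ji; rewrite mxE big1 // => k _.
have [le_ki | lt_ik] := leqP k i.
  by rewrite (strictly_upperP _ (UT_mxP a)) ?mul0r.
by rewrite (strictly_upperP _ (UT_mxP b)) ?mulr0 // (leq_trans le_ji) // ltnW.
Qed.

Definition UT_mul (a b : UT) : UT := MkUT (UT_mul_subproof a b).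

Lemma UT_mulA : associative UT_mul.
Proof. by move=> a b c; apply: val_inj; rewrite /= mulmxA. Qed.

Lemma UT_mul_bilinear : bilinear_for *:%R *:%R UT_mul.
Proof.
split=> [b a u v|b a u v]; apply: val_inj.
  by rewrite /= mulmxDl -scalemxAl.
by rewrite /= mulmxDr -scalemxAr.
Qed.

Lemma UT_unit_subproof (i j : 'I_n) :
  (i < j)%N -> (delta_mx i j : 'M[K]_n) \in strictly_upper.
Proof.
move=> lt_ij; apply/strictly_upperP=> k l; rewrite mxE.
by case: eqP => [->|//]; case: eqP => [->|//]; rewrite leqNgt lt_ij.
Qed.

Definition UT_unit (i j : 'I_n) (lt_ij : (i < j)%N) : UT :=
  MkUT (UT_unit_subproof lt_ij).

End StrictlyUpperTriangular.

Arguments UT_mul {K n}.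
Arguments UT_unit K {n i j}.

Notation "'UT_3' K" := (UT K 3) (at level 10, K at level 9).

Inductive UT3_basis := E12 | E23 | E13.

(* Rows and columns are numbered from 0. *)
Definition basis_row (x : UT3_basis) : 'I_3 :=
  match x with
  | E12 | E13 => Ordinal (isT : 0 < 3)%N
  | E23 => Ordinal (isT : 1 < 3)%N
  end.

Definition basis_col (x : UT3_basis) : 'I_3 :=
  match x with
  | E12 => Ordinal (isT : 1 < 3)%N
  | E23 | E13 => Ordinal (isT : 2 < 3)%N
  end.

Lemma basis_row_lt_col (x : UT3_basis) : (basis_row x < basis_col x)%N.
Proof. by case: x. Qed.

(* The parameters are arguments of the constructors, so that different
   parameter values are different structures. *)
Inductive UT3_structure (K : Type) :=
  | Structure1
  | Structure2
  | Structure3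
  | Structure4 (alpha beta gamma : K)
  | Structure5
  | Structure6
  | Structure7 (alpha beta : K)
  | Structure8 (alpha beta : K).

Section Structures.
Variable K : fieldType.

Definition basis_elt (x : UT3_basis) : UT_3 K :=
  UT_unit K (basis_row_lt_col x).

Local Notation e12 := (basis_elt E12).
Local Notation e23 := (basis_elt E23).
Local Notation e13 := (basis_elt E13).

Definition structure_table (s : UT3_structure K) (x y : UT3_basis) : UT_3 K :=
  match s with
  | Structure1 =>
      match x, y with
      | E13, E23 => e13
      | E23, E12 => e12
      | E23, E13 => e13
      | E23, E23 => e23
      | _, _ => 0
      end
  | Structure2 =>
      match x, y with
      | E12, E12 => e12
      | E12, E13 => e13
      | E13, E23 => e13
      | E23, E23 => e23
      | _, _ => 0
      end
  | Structure3 =>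
      match x, y with
      | E13, E23 => e13
      | E23, E23 => e23
      | _, _ => 0
      end
  | Structure4 alpha beta gamma =>
      match x, y with
      | E12, E12 => alpha *: e13
      | E12, E23 => beta *: e13
      | E23, E12 => gamma *: e13
      | E23, E23 => e13
      | _, _ => 0
      end
  | Structure5 =>
      match x, y with
      | E12, E12 => e12
      | E12, E13 => e13
      | E23, E12 => e23
      | E13, E12 => e13
      | _, _ => 0
      end
  | Structure6 =>
      match x, y with
      | E12, E12 => e12
      | E12, E13 => e13
      | _, _ => 0
      end
  | Structure7 alpha beta =>
      match x, y with
      | E12, E12 => e13
      | E12, E23 => alpha *: e13
      | E23, E12 => beta *: e13
      | _, _ => 0
      end
  | Structure8 alpha beta =>
      match x, y with
      | E12, E23 => alpha *: e13
      | E23, E12 => beta *: e13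
      | _, _ => 0
      end
  end.

Definition basis_coord (a : UT_3 K) (x : UT3_basis) : K :=
  UT_mx a (basis_row x) (basis_col x).

(* The bilinear extension of the multiplication table. *)
Definition structure_product (s : UT3_structure K) (a b : UT_3 K) : UT_3 K :=
  \sum_(x <- [:: E12; E23; E13]) \sum_(y <- [:: E12; E23; E13])
    (basis_coord a x * basis_coord b y) *: structure_table s x y.

End Structures.

(* Main.v *)
Require Import Defs.
From HB Require Import structures.
From mathcomp Require Import all_boot all_order all_algebra.
From mathcomp Require Import sesquilinear ring.

(** Write x = e12, y = e23, z = e13, so that x y = z is the only nonzero
    product of basis elements.

    The two compatibility identities, applied to the factorization z = x y and
    to the relations x x = y y = 0, already determine the shape of a matching
    product: z * w is the y-coordinate of y * w times z, v * z is the
    x-coordinate of v * x times z, x * w has no y-coordinate and v * y has no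
    x-coordinate.  Only eight scalars remain free, the eight coefficients of
    the type [coefs], and conversely every choice of them gives a bilinear
    product satisfying both compatibility identities
    ([matching_product_exists], [matching_product_matching]).  Associativity
    then becomes a system of quadratic equations in these scalars
    ([associative_coefs]).

    An automorphism is determined by the images of x and y; as x x = y y = 0
    and phi z = phi x phi y must be nonzero, it sends x to p x + r z, y to
    t y + u z and z to p t z with p, t nonzero ([automorphism_aut]).  Hence
    isomorphism of two matching products is an explicit relation between their
    coefficients ([matching_product_isomorphicP]).

    Both halves of the classification go through one function [classify],
    which reads the name of the normal form off the coefficients by testing
    them for zero.  It is constant on isomorphism classes
    ([related_classify_eq]) and returns s on the s-th normal form
    ([classify_structure]), so a product is isomorphic to at most one normal
    form; and for an associative product the quadratic equations make the
    product isomorphic to the form that [classify] names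
    ([related_to_normal_form]). *)

Set Implicit Arguments.
Unset Strict Implicit.
Unset Printing Implicit Defensive.

Import GRing.Theory.

Section Classification.
Local Open Scope ring_scope.
Variable K : fieldType.
Implicit Types (a b c v w : UT_3 K) (star : UT_3 K -> UT_3 K -> UT_3 K).
Implicit Types (p q r t u : K) (s : UT3_structure K) (x y z : UT3_basis).

Local Notation e12 := (basis_elt K E12).
Local Notation e23 := (basis_elt K E23).
Local Notation e13 := (basis_elt K E13).
Local Notation mul := (@UT_mul K 3).
Local Notation "a .{ x }" := (basis_coord a x)
  (at level 2, left associativity, format "a .{ x }").

(** * Coordinates in the algebra *)

(** Turns the use of a hypothesis that matches the goal only up to expanding and
    moving terms across the equality sign into an identity for [ring]. *)
Lemma eq_of_sub (l l' m m' : K) : m = m' -> l - l' = m - m' -> l = l'.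
Proof. by move=> -> /eqP; rewrite subrr subr_eq0 => /eqP. Qed.

Lemma coord_inj a b : (forall x, a.{x} = b.{x}) -> a = b.
Proof.
move=> eq_ab; apply: val_inj; apply/matrixP=> i j /=.
have [le_ji | lt_ij] := leqP j i.
  by rewrite !(strictly_upperP _ (UT_mxP _)).
case: i j lt_ij => [[|[|[|i]]] lti] [[|[|[|j]]] ltj] //= _.
- by have := eq_ab E12; congr (UT_mx a _ _ = UT_mx b _ _); apply: val_inj.
- by have := eq_ab E13; congr (UT_mx a _ _ = UT_mx b _ _); apply: val_inj.
- by have := eq_ab E23; congr (UT_mx a _ _ = UT_mx b _ _); apply: val_inj.
Qed.

Lemma coordD a b x : (a + b).{x} = a.{x} + b.{x}.
Proof. by rewrite /basis_coord /= mxE. Qed.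

Lemma coordZ p a x : (p *: a).{x} = p * a.{x}.
Proof. by rewrite /basis_coord /= mxE. Qed.

Lemma coord0 x : (0 : UT_3 K).{x} = 0.
Proof. by rewrite /basis_coord /= mxE. Qed.

Definition same_basis x y : bool :=
  match x, y with E12, E12 | E23, E23 | E13, E13 => true | _, _ => false end.

Lemma coord_basis x y : (basis_elt K x).{y} = (same_basis x y)%:R.
Proof. by case: x y => [] []; rewrite /basis_coord /= mxE. Qed.

Lemma coord_mul a b x :
  (mul a b).{x} = if x is E13 then a.{E12} * b.{E23} else 0.
Proof.
have lower v (i j : 'I_3) : (j <= i)%N -> UT_mx v i j = 0.
  by move=> le_ji; rewrite (strictly_upperP _ (UT_mxP v)).
rewrite /basis_coord /= mxE !big_ord_recl big_ord0 addr0.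
case: x => /=.
- rewrite (lower a _ ord0) // (lower b (lift ord0 ord0)) //.
  by rewrite (lower b (lift ord0 (lift _ _))) // mul0r !mulr0 !addr0.
- rewrite (lower a _ ord0) // (lower a _ (lift ord0 ord0)) //.
  by rewrite (lower b (lift ord0 (lift _ _))) // !mul0r mulr0 !addr0.
- rewrite (lower a _ ord0) // (lower b (lift ord0 (lift _ _))) //.
  rewrite mul0r mulr0 addr0 add0r.
  by congr (UT_mx a _ _ * UT_mx b _ _); apply: val_inj.
Qed.

Definition vec p q r : UT_3 K := p *: e12 + q *: e23 + r *: e13.

Lemma coord_vec p q r x :
  (vec p q r).{x} = match x with E12 => p | E23 => q | E13 => r end.
Proof. by rewrite !(coordD, coordZ, coord_basis); case: x => /=; ring. Qed.

Lemma vec_coord a : a = vec a.{E12} a.{E23} a.{E13}.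
Proof. by apply: coord_inj => x; rewrite coord_vec; case: x. Qed.

Lemma eq_vec a p q r :
  a.{E12} = p -> a.{E23} = q -> a.{E13} = r -> a = vec p q r.
Proof. by move=> <- <- <-; apply: vec_coord. Qed.

Lemma mul_basis x y :
  mul (basis_elt K x) (basis_elt K y) =
  match x, y with E12, E23 => e13 | _, _ => 0 end.
Proof.
by apply: coord_inj => z; rewrite coord_mul; case: x y z => [] [] [];
  rewrite /= ?coord_basis ?coord0 /= ?mulr0 ?mul0r ?mulr1.
Qed.

Lemma linear_vec (f : UT_3 K -> UT_3 K) p q r : linear f ->
  f (vec p q r) = p *: f e12 + q *: f e23 + r *: f e13.
Proof.
move=> lin_f.
have f0 : f 0 = 0 by have := lin_f (-1) 0 0; rewrite scaler0 add0r scaleN1r addNr.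
rewrite /vec addrC !lin_f addrC; congr (_ + _).
by rewrite -[q *: e23]addr0 !lin_f f0 !addr0.
Qed.

(** * Matching products have eight free coefficients *)

(** The field [xy_z] is the coefficient of e13 in e12 * e23, and similarly for
    the others; these are the entries of the multiplication table of e12 and
    e23 that the compatibility identities do not force to vanish. *)
Record coefs := Coefs
  { xx_x : K; xx_z : K; xy_z : K; yx_x : K; yx_y : K; yx_z : K;
    yy_y : K; yy_z : K }.
Implicit Type k : coefs.

(** In the last two terms of the e13-coordinate, e13 * w is the e23-coordinate
    of e23 * w times e13, and v * e13 is the e12-coordinate of v * e12
    times e13. *)
Definition matching_product k v w : UT_3 K :=
  vec (xx_x k * (v.{E12} * w.{E12}) + yx_x k * (v.{E23} * w.{E12}))
      (yx_y k * (v.{E23} * w.{E12}) + yy_y k * (v.{E23} * w.{E23}))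
      (xx_z k * (v.{E12} * w.{E12}) + xy_z k * (v.{E12} * w.{E23})
       + yx_z k * (v.{E23} * w.{E12}) + yy_z k * (v.{E23} * w.{E23})
       + (yx_y k * w.{E12} + yy_y k * w.{E23}) * v.{E13}
       + (xx_x k * v.{E12} + yx_x k * v.{E23}) * w.{E13}).

Lemma matching_product_bilinear k : bilinear_for *:%R *:%R (matching_product k).
Proof.
by split=> [w p v v'|v p w w']; apply: coord_inj => x;
  rewrite /= /matching_product !(coord_vec, coordD, coordZ); case: x; ring.
Qed.

Lemma matching_product_matching k :
  associative (matching_product k) -> id_matching mul (matching_product k).
Proof.
move=> genA; split=> //; first exact: matching_product_bilinear.
  move=> a b c; apply: coord_inj => x.
  by rewrite /matching_product !(coord_mul, coord_vec); case: x; ring.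
move=> a b c; apply: coord_inj => x.
by rewrite /matching_product !(coord_mul, coord_vec); case: x; ring.
Qed.

(** Bilinearity reduces everything to products of basis elements; the
    identities for e13 = e12 e23 and for e12 e12 = e23 e23 = 0 give those with
    a factor e13 and kill the coordinates missing from [coefs]. *)
Lemma matching_product_exists star : id_matching mul star ->
  exists2 k, star =2 matching_product k & associative star.
Proof.
case=> [[linl linr] starA matchl matchr].
have linl' w : linear (star^~ w) by apply: linl.
have linr' v : linear (star v) by apply: linr.
have star0v w : star 0 w = 0.
  by have := linl' w (-1) 0 0; rewrite scaler0 add0r scaleN1r addNr.
have starv0 v : star v 0 = 0.
  by have := linr' v (-1) 0 0; rewrite scaler0 add0r scaleN1r addNr.
have x_y w : (star e12 w).{E23} = 0.
  have := matchl e12 e12 w; rewrite mul_basis star0v => /(congr1 (fun v => v.{E13})).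
  by rewrite coord0 coord_mul coord_basis mul1r.
have y_x v : (star v e23).{E12} = 0.
  have := matchr v e23 e23; rewrite mul_basis starv0 => /(congr1 (fun v => v.{E13})).
  by rewrite coord0 coord_mul coord_basis mulr1.
have zE w : star e13 w = vec 0 0 (star e23 w).{E23}.
  have := matchl e12 e23 w; rewrite mul_basis => ->.
  by apply: eq_vec; rewrite coord_mul // coord_basis mul1r.
have Ez v : star v e13 = vec 0 0 (star v e12).{E12}.
  have := matchr v e12 e23; rewrite mul_basis => <-.
  by apply: eq_vec; rewrite coord_mul // coord_basis mulr1.
exists (Coefs (star e12 e12).{E12} (star e12 e12).{E13}
  (star e12 e23).{E13} (star e23 e12).{E12} (star e23 e12).{E23}
  (star e23 e12).{E13} (star e23 e23).{E23} (star e23 e23).{E13}) => //.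
move=> v w; rewrite /matching_product /=; move: v.{E12} v.{E23} v.{E13} (vec_coord v).
move=> v1 v2 v3 ->; move: w.{E12} w.{E23} w.{E13} (vec_coord w).
move=> w1 w2 w3 ->; rewrite (linear_vec _ _ _ (linl' _)) /=.
rewrite (linear_vec _ _ _ (linr' e12)) (linear_vec _ _ _ (linr' e23)).
rewrite (linear_vec _ _ _ (linr' e13)).
by apply: eq_vec; rewrite !(coordD, coordZ) ?zE ?Ez !coord_vec ?x_y ?y_x; ring.
Qed.

(** * The eight normal forms *)

Definition structure_coefs s : coefs :=
  match s with
  | Structure1 => Coefs 0 0 0 1 0 0 1 0
  | Structure2 => Coefs 1 0 0 0 0 0 1 0
  | Structure3 => Coefs 0 0 0 0 0 0 1 0
  | Structure4 alpha beta gamma => Coefs 0 alpha beta 0 0 gamma 0 1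
  | Structure5 => Coefs 1 0 0 0 1 0 0 0
  | Structure6 => Coefs 1 0 0 0 0 0 0 0
  | Structure7 alpha beta => Coefs 0 1 alpha 0 0 beta 0 0
  | Structure8 alpha beta => Coefs 0 0 alpha 0 0 beta 0 0
  end.

Lemma structure_productE s :
  structure_product s =2 matching_product (structure_coefs s).
Proof.
move=> v w; rewrite /structure_product !big_cons !big_nil.
by apply: eq_vec; rewrite !(coordD, coordZ, coord0);
  case: s => [|||? ? ?|||? ?|? ?] /=;
  rewrite ?(coordZ, coord_basis, coord0) /=; ring.
Qed.

Lemma structure_matching s : id_matching mul (structure_product s).
Proof.
have genA : associative (matching_product (structure_coefs s)).
  move=> a b c; apply: coord_inj => x; rewrite /matching_product !coord_vec.
  by case: s x => [|||? ? ?|||? ?|? ?] [] /=; ring.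
have [[linl linr] _ matchl matchr] := matching_product_matching genA.
split; first split.
- by move=> w p v v'; rewrite !structure_productE; apply: linl.
- by move=> v p w w'; rewrite !structure_productE; apply: linr.
- by move=> a b c; rewrite !structure_productE.
- by move=> a b c; rewrite !structure_productE.
- by move=> a b c; rewrite !structure_productE.
Qed.

(** * Associativity in coefficients *)

(** Each equation is one coordinate of the associativity of one triple of
    basis elements among e12 and e23. *)
Lemma associative_coefs k : associative (matching_product k) ->
  [/\ [/\ yx_x k * xx_x k = 0, yx_x k * yx_y k = 0,
          yx_y k ^+ 2 = xx_x k * yx_y k & yx_x k ^+ 2 = yx_x k * yy_y k],
      yx_y k * yy_y k = 0,
      [/\ xx_z k * yx_y k = xx_z k * xx_x k, xx_z k * yy_y k = 0 &
          xx_z k * yx_x k + yx_z k * xx_x k = 0] &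
      [/\ yy_z k * yx_x k = yy_z k * yy_y k, yy_z k * xx_x k = 0 &
          yy_z k * yx_y k + yx_z k * yy_y k = 0]].
Proof.
move=> genA.
have assocE x y z i :
    (matching_product k (basis_elt K x)
       (matching_product k (basis_elt K y) (basis_elt K z))).{i} =
    (matching_product k (matching_product k (basis_elt K x) (basis_elt K y))
       (basis_elt K z)).{i}.
  by rewrite genA.
move: assocE; rewrite /matching_product => assocE.
by do ![split];
  [ apply: eq_of_sub (assocE E12 E23 E12 E12) _
  | apply: eq_of_sub (assocE E23 E23 E12 E23) _
  | apply: eq_of_sub (esym (assocE E23 E12 E12 E23)) _
  | apply: eq_of_sub (assocE E23 E23 E12 E12) _
  | apply: eq_of_sub (esym (assocE E23 E12 E23 E23)) _
  | apply: eq_of_sub (esym (assocE E12 E12 E12 E13)) _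
  | apply: eq_of_sub (esym (assocE E12 E12 E23 E13)) _
  | apply: eq_of_sub (assocE E12 E23 E12 E13) _
  | apply: eq_of_sub (assocE E23 E23 E23 E13) _
  | apply: eq_of_sub (assocE E12 E23 E23 E13) _
  | apply: eq_of_sub (esym (assocE E23 E12 E23 E13)) _ ];
  rewrite !(coord_vec, coord_basis) /=; ring.
Qed.

(** * Automorphisms and isomorphisms *)

Definition aut p t r u v : UT_3 K :=
  vec (p * v.{E12}) (t * v.{E23})
      (r * v.{E12} + u * v.{E23} + p * t * v.{E13}).

Lemma aut_automorphism p t r u : p != 0 -> t != 0 ->
  algebra_automorphism mul (aut p t r u).
Proof.
move=> p0 t0; split.
- move=> q v w; apply: coord_inj => x.
  by rewrite /aut !(coord_vec, coordD, coordZ); case: x; ring.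
- exists (fun v => vec (v.{E12} / p) (v.{E23} / t)
    ((v.{E13} - r * (v.{E12} / p) - u * (v.{E23} / t)) / (p * t))) => v;
  apply: coord_inj => x; rewrite /aut !coord_vec; case: x; field; rewrite ?p0 ?t0 //.
- move=> v w; apply: coord_inj => x.
  by rewrite /aut !(coord_mul, coord_vec); case: x; ring.
Qed.

(** The images of e12 and e23 still have square zero, so each of them has a
    vanishing e12- or e23-coordinate; the image of e13 is their product and is
    nonzero by injectivity, which decides which coordinates vanish. *)
Lemma automorphism_aut phi : algebra_automorphism mul phi ->
  exists p t r u, [/\ p != 0, t != 0 & phi =1 aut p t r u].
Proof.
case=> lin_phi /bij_inj inj_phi phiM.
have phi0 : phi 0 = 0.
  by have := lin_phi (-1) 0 0; rewrite scaler0 add0r scaleN1r addNr.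
have phi_xx := phiM e12 e12; have phi_yy := phiM e23 e23.
have phi_z := phiM e12 e23; rewrite !mul_basis ?phi0 in phi_xx phi_yy phi_z.
have {}phi_xx : (phi e12).{E12} * (phi e12).{E23} = 0.
  by have := congr1 (fun v => v.{E13}) phi_xx; rewrite coord0 coord_mul.
have {}phi_yy : (phi e23).{E12} * (phi e23).{E23} = 0.
  by have := congr1 (fun v => v.{E13}) phi_yy; rewrite coord0 coord_mul.
have {}phi_z : phi e13 = vec 0 0 ((phi e12).{E12} * (phi e23).{E23}).
  by apply: eq_vec; rewrite phi_z coord_mul.
have : (phi e12).{E12} * (phi e23).{E23} != 0.
  apply/eqP=> pt0; have /inj_phi/(congr1 (fun v => v.{E13})) : phi e13 = phi 0.
    by rewrite phi0 phi_z pt0 /vec !scale0r !addr0.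
  by rewrite coord_basis coord0 => /eqP; rewrite oner_eq0.
rewrite mulf_eq0 negb_or => /andP[p0 t0].
move/eqP: phi_xx; rewrite mulf_eq0 (negPf p0) /= => /eqP x_y.
move/eqP: phi_yy; rewrite mulf_eq0 (negPf t0) orbF => /eqP y_x.
exists (phi e12).{E12}, (phi e23).{E23}, (phi e12).{E13}, (phi e23).{E13}.
split=> // v; rewrite [in LHS](vec_coord v) (linear_vec _ _ _ lin_phi) phi_z.
by apply: eq_vec; rewrite 2!coordD 3!coordZ coord_vec ?x_y ?y_x; ring.
Qed.

(** The equations are those expressing that [aut p t r u] is a morphism from
    the product of k to that of k', with the invertible common factors
    cancelled and the first four substituted into the others.  Those four
    concern the leading coefficients, which describe the product modulo e13;
    they are only rescaled, while r and u change the coefficients of e13 by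
    multiples of leading ones. *)
Definition related k k' p t r u : Prop :=
  [/\ [/\ xx_x k = p * xx_x k', yx_x k = t * yx_x k',
          yx_y k = p * yx_y k' & yy_y k = t * yy_y k'],
      t * xx_z k = p * xx_z k' + r * yx_y k',
      p * t * xy_z k = p * t * xy_z k' + r * t * yy_y k' + p * u * xx_x k',
      yx_z k = yx_z k' &
      p * yy_z k = t * yy_z k' + u * yx_x k'].

(** It suffices to compare images on e12 and e23: the products involving e13
    are determined by the others through the compatibility identities, which
    an automorphism respects. *)
Lemma matching_product_isomorphicP star star' k k' :
  star =2 matching_product k -> star' =2 matching_product k' ->
  id_matching_isomorphic mul star star' <->
  exists p t r u, [/\ p != 0, t != 0 & related k k' p t r u].
Proof.
move=> starE starE'; split=> [[phi]|[p [t [r [u [p0 t0 rel]]]]]].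
  case/automorphism_aut=> p [t [r [u [p0 t0 phiE]]]] phiM.
  exists p, t, r, u; split=> //.
  have coordM x y z :
      (aut p t r u (matching_product k (basis_elt K x) (basis_elt K y))).{z} =
      (matching_product k' (aut p t r u (basis_elt K x))
         (aut p t r u (basis_elt K y))).{z}.
    by rewrite -starE -starE' -!phiE phiM.
  move: coordM; rewrite /aut /matching_product => coordM.
  case: k k' starE starE' coordM => a b c d e f g h [a' b' c' d' e' f' g' h'] _ _.
  rewrite /related /= => coordM.
  have aE : a = p * a'.
    apply: (mulfI p0); apply: eq_of_sub (coordM E12 E12 E12) _.
    by rewrite !(coord_vec, coord_basis) /=; ring.
  have dE : d = t * d'.
    apply: (mulfI p0); apply: eq_of_sub (coordM E23 E12 E12) _.
    by rewrite !(coord_vec, coord_basis) /=; ring.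
  have eE : e = p * e'.
    apply: (mulfI t0); apply: eq_of_sub (coordM E23 E12 E23) _.
    by rewrite !(coord_vec, coord_basis) /=; ring.
  have gE : g = t * g'.
    apply: (mulfI t0); apply: eq_of_sub (coordM E23 E23 E23) _.
    by rewrite !(coord_vec, coord_basis) /=; ring.
  rewrite {}aE {}dE {}eE {}gE in coordM *; split=> //.
  - apply: (mulfI p0); apply: eq_of_sub (coordM E12 E12 E13) _.
    by rewrite !(coord_vec, coord_basis) /=; ring.
  - apply: eq_of_sub (coordM E12 E23 E13) _.
    by rewrite !(coord_vec, coord_basis) /=; ring.
  - apply: (mulfI p0); apply: (mulfI t0); apply: eq_of_sub (coordM E23 E12 E13) _.
    by rewrite !(coord_vec, coord_basis) /=; ring.
  - apply: (mulfI t0); apply: eq_of_sub (coordM E23 E23 E13) _.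
    by rewrite !(coord_vec, coord_basis) /=; ring.
exists (aut p t r u); first exact: aut_automorphism.
move=> v w; rewrite starE starE'; apply: coord_inj => x.
case: k k' rel {starE starE'} => a b c d e f g h [a' b' c' d' e' f' g' h'].
case=> [[/= -> -> -> ->] bE cE -> hE]; rewrite /aut /matching_product !coord_vec /=.
case: x; [by ring | by ring |]; apply/eqP; rewrite -subr_eq0; apply/eqP.
(* The difference of both sides is linear in the defects of the equations. *)
pose dev m m' : K := m - m'.
transitivity (p * (v.{E12} * w.{E12}) * dev (t * b) (p * b' + r * e')
  + v.{E12} * w.{E23} * dev (p * t * c) (p * t * c' + r * t * g' + p * u * a')
  + t * (v.{E23} * w.{E23}) * dev (p * h) (t * h' + u * d')).
  by rewrite /dev; ring.
by rewrite bE cE hE /dev !subrr !mulr0 !addr0.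
Qed.

(** * The complete invariant *)

(** In the nilpotent case the scalars p, t act on the coefficients of e12 * e12
    and e23 * e23 by the inverse factors t / p and p / t, which is why their
    product, together with the invariant [xy_z] and [yx_z], is what remains
    as parameters once the coefficient of e23 * e23 is scaled to 1. *)
Definition classify k : UT3_structure K :=
  if yx_y k != 0 then Structure5 K
  else if yx_x k != 0 then Structure1 K
  else if xx_x k != 0 then if yy_y k != 0 then Structure2 K else Structure6 K
  else if yy_y k != 0 then Structure3 K
  else if yy_z k != 0 then Structure4 (xx_z k * yy_z k) (xy_z k) (yx_z k)
  else if xx_z k != 0 then Structure7 (xy_z k) (yx_z k)
  else Structure8 (xy_z k) (yx_z k).

Lemma classify_structure s : classify (structure_coefs s) = s.
Proof.
by case: s => [|||? ? ?|||? ?|? ?]; rewrite /classify /= ?oner_eq0 ?eqxx ?mulr1.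
Qed.

(** The four leading coefficients are only rescaled, so the tests on them agree.
    When they all vanish, r and u disappear from the equations and the
    remaining data is only rescaled too. *)
Lemma related_classify_eq k k' p t r u : p != 0 -> t != 0 ->
  related k k' p t r u -> classify k = classify k'.
Proof.
move=> p0 t0; case: k k' => a b c d e f g h [a' b' c' d' e' f' g' h'].
rewrite /related /classify /= => -[[-> -> -> ->] bE cE -> hE].
rewrite !mulf_eq0 (negPf p0) (negPf t0) /=.
case: (eqVneq e' 0) bE => [-> | //]; case: (eqVneq d' 0) hE => [-> | //].
rewrite !mulr0 !addr0 => hE bE.
case: (eqVneq a' 0) cE => [-> | //]; case: (eqVneq g' 0) => [-> | //].
rewrite !mulr0 !addr0 => /(mulfI (mulf_neq0 p0 t0)) ->.
have -> : (h == 0) = (h' == 0).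
  by have := congr1 (eq_op^~ 0) hE; rewrite !mulf_eq0 (negPf p0) (negPf t0).
have -> : (b == 0) = (b' == 0).
  by have := congr1 (eq_op^~ 0) bE; rewrite !mulf_eq0 (negPf p0) (negPf t0).
suff -> : b * h = b' * h' by [].
apply: (mulfI (mulf_neq0 p0 t0)); transitivity (t * b * (p * h)); first by ring.
by rewrite bE hE; ring.
Qed.

(** Associativity forces the leading coefficients of a nonnilpotent product to
    be those of a normal form up to scaling.  The witnesses p, t scale the
    nonzero ones to 1, and r, u remove what associativity leaves in e13. *)
Lemma related_to_normal_form k : associative (matching_product k) ->
  exists p t r u, [/\ p != 0, t != 0 &
    related k (structure_coefs (classify k)) p t r u].
Proof.
move/associative_coefs; rewrite /classify /related.
case: k => a b c d e f g h /=.
case=> [[da de ee dd] eg [be bg dbfa] [hd ha ehfg]].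
have cancel (m n : K) : m != 0 -> m * n = 0 -> n = 0.
  by move=> m0 /eqP; rewrite mulf_eq0 (negPf m0) => /eqP.
case: (eqVneq e 0) => [e0|e_n0] /=; last first.
  have aE : a = e by apply/esym/(mulIf e_n0); rewrite -ee.
  have g0 : g = 0 by apply: cancel eg.
  have d0 : d = 0 by apply: (cancel e) => //; rewrite mulrC.
  have h0 : h = 0 by apply: (cancel a); rewrite ?aE // mulrC -{1}aE.
  have f0 : f = 0 by apply: (cancel e) => //; move: dbfa; rewrite aE d0 mulr0 add0r mulrC.
  exists e, 1, b, c; rewrite aE d0 g0 h0 f0 oner_neq0; split=> //.
  by do ![split]; ring.
case: (eqVneq d 0) => [d0|d_n0] /=; last first.
  have gE : g = d by apply/esym/(mulfI d_n0); rewrite -dd.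
  have a0 : a = 0 by apply: cancel da.
  have b0 : b = 0 by apply: (cancel d) => //; move: dbfa; rewrite a0 mulr0 addr0 mulrC.
  have f0 : f = 0 by apply: (cancel d) => //; move: ehfg; rewrite e0 mulr0 add0r gE mulrC.
  exists 1, d, c, h; rewrite gE a0 b0 f0 e0 oner_neq0; split=> //.
  by do ![split]; ring.
rewrite e0 d0 !mulr0 !add0r in be dbfa hd ehfg *.
case: (eqVneq a 0) => [a0|a_n0] /=; last first.
  have b0 : b = 0 by apply: (cancel a) => //; rewrite mulrC.
  have f0 : f = 0 by apply: (cancel a) => //; rewrite mulrC.
  have h0 : h = 0 by apply: (cancel a) => //; rewrite mulrC.
  case: (eqVneq g 0) => [g0|g_n0] /=.
    exists a, 1, 0, c; rewrite g0 b0 f0 h0 oner_neq0; split=> //.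
    by do ![split]; ring.
  (* Here r and u act on the same coefficient; r alone removes it. *)
  exists a, g, (c * a), 0; rewrite b0 f0 h0; split=> //.
  by do ![split]; ring.
case: (eqVneq g 0) => [g0|g_n0] /=; last first.
  have b0 : b = 0 by apply: (cancel g) => //; rewrite mulrC.
  have f0 : f = 0 by apply: (cancel g) => //; rewrite mulrC.
  have h0 : h = 0 by apply: (cancel g) => //; rewrite mulrC.
  exists 1, g, c, 0; rewrite a0 b0 f0 h0 oner_neq0; split=> //.
  by do ![split]; ring.
rewrite a0 g0.
case: (eqVneq h 0) => [h0|h_n0] /=; last first.
  by exists 1, h, 0, 0; rewrite oner_neq0; split=> //; do ![split]; ring.
rewrite h0; case: (eqVneq b 0) => [b0|b_n0] /=.
  by exists 1, 1, 0, 0; rewrite b0 oner_neq0; split=> //; do ![split]; ring.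
by exists b, 1, 0, 0; rewrite oner_neq0; split=> //; do ![split]; ring.
Qed.

End Classification.

Theorem proposition2p13 (K : fieldType) :
  (forall s : UT3_structure K,
     id_matching (@UT_mul K 3) (structure_product s)) /\
  (forall star : UT_3 K -> UT_3 K -> UT_3 K,
     id_matching (@UT_mul K 3) star ->
     exists! s : UT3_structure K,
       id_matching_isomorphic (@UT_mul K 3) star (structure_product s)).
Proof.
split=> [|star /matching_product_exists[k starE starA]]; first exact: structure_matching.
have isoP s := matching_product_isomorphicP starE (@structure_productE K s).
have genA : associative (matching_product k) by move=> a b c; rewrite -!starE.
exists (classify k); split; first exact/isoP/related_to_normal_form.
move=> s /isoP[p [t [r [u [p0 t0 rel]]]]].
by rewrite (related_classify_eq p0 t0 rel) classify_structure.
Qed.
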